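(* Let $\mathcal{S}=\langle\mathbf{Fm},\vdash\rangle$ be a Hilbert-style logic with axioms $A$ and rules $R_\mathcal{S}$, let $\mathcal{S}^l=\langle\mathbf{Fm},\vdash^l\rangle$ be its left variable inclusion companion and $\mathcal{S}^{re}=\langle\mathbf{Fm},\vdash^{re}\rangle$ its restricted rules companion. Then for all $\Sigma\cup\{\varphi\}\subseteq\mathit{Fm}$, if $\Sigma\vdash^{re}\varphi$ then $\Sigma\vdash^l\varphi$; that is, $\vdash^{re}\subseteq\vdash^l$.
   Context: $\mathbf{Fm}$ is the formula algebra of a logical language $\mathcal{L}$ (connectives of finite arity) over a countably infinite set $V$ of variables, universe $\mathit{Fm}$. A Hilbert-style logic is given by schematic (substitution-closed) sets of axioms $A\subseteq\mathit{Fm}$ and rules $R\subseteq\mathcal{P}(\mathit{Fm})\times\mathit{Fm}$ (written $\frac{\Gamma}{\alpha}$); $\Sigma\vdash\varphi$ iff there is a finite sequence ending in $\varphi$ each member of which is an axiom, a member of $\Sigma$, or obtained from earlier members by a rule. $\mathrm{var}(\varphi)$ is the set of variables of $\varphi$, $\mathrm{var}(\Gamma)=\bigcup_{\gamma\in\Gamma}\mathrm{var}(\gamma)$. Left variable inclusion companion: $\Gamma\vdash^l\varphi$ iff there is $\Gamma'\subseteq\Gamma$ with $\mathrm{var}(\Gamma')\subseteq\mathrm{var}(\varphi)$ and $\Gamma'\vdash\varphi$. Restricted rules companion $\mathcal{S}^{re}$: the Hilbert-style logic with the same axioms $A$ and rules $\{\frac{\Gamma}{\alpha}\in R_\mathcal{S}\mid\mathrm{var}(\Gamma)\subseteq\mathrm{var}(\alpha)\}$.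 *)

(* Defs.v *)
From Stdlib Require List.
From mathcomp Require Import all_boot.
From mathcomp Require Import boolp classical_sets functions cardinality.

Set Implicit Arguments.
Unset Strict Implicit.
Unset Printing Implicit Defensive.

Local Open Scope classical_set_scope.

Record language := Language {
  connective :> Type;
  arity : connective -> nat }.

Inductive formula (L : language) (V : Type) : Type :=
| Var of V
| Conn (c : L) of 'I_(arity c) -> formula L V.

Arguments Var {L V} _.
Arguments Conn {L V} c _.

Section Formulas.
Variables (L : language) (V : Type).
Local Notation Fm := (formula L V).

Fixpoint var (phi : Fm) : set V :=
  match phi with
  | Var x => [set x]
  | Conn c args => \bigcup_(i in [set: 'I_(arity c)]) var (args i)
  end.

Definition vars (Gamma : set Fm) : set V := \bigcup_(gamma in Gamma) var gamma.

(* Endomorphisms of the formula algebra correspond to maps V -> Fm. *)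
Fixpoint subst (sigma : V -> Fm) (phi : Fm) : Fm :=
  match phi with
  | Var x => sigma x
  | Conn c args => Conn c (fun i => subst sigma (args i))
  end.

Lemma var_subst sigma phi :
  var (subst sigma phi) = \bigcup_(x in var phi) var (sigma x).
Proof.
elim: phi => [x|c args IH] /=; first by rewrite bigcup_set1.
apply/seteqP; split => y /=.
  by move=> [i _]; rewrite IH => -[x xi yx]; exists x => //; exists i.
by move=> [x [i _ xi] yx]; exists i => //; rewrite IH; exists x.
Qed.

End Formulas.

Record hilbert_logic (L : language) (V : Type) := HilbertLogic {
  axioms : set (formula L V);
  rules : set (set (formula L V) * formula L V);
  axioms_subst : forall sigma alpha,
    axioms alpha -> axioms (subst sigma alpha);
  rules_subst : forall sigma Gamma alpha,
    rules (Gamma, alpha) -> rules (subst sigma @` Gamma, subst sigma alpha) }.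

Section Companions.
Variables (L : language) (V : Type).
Local Notation Fm := (formula L V).

(* Premise sets of rules may be infinite, but a rule can only be applied when
   all its premises occur among the finitely many earlier formulas. *)
Definition derivation (S : hilbert_logic L V) (Sigma : set Fm) (s : seq Fm) :=
  forall s1 alpha s2, s = s1 ++ alpha :: s2 ->
    [\/ axioms S alpha,
        Sigma alpha
      | exists2 Gamma, rules S (Gamma, alpha) &
                       Gamma `<=` [set gamma | List.In gamma s1] ].

Definition entails (S : hilbert_logic L V) (Sigma : set Fm) (phi : Fm) : Prop :=
  exists s, derivation S Sigma (rcons s phi).

Definition left_companion (entl : set Fm -> Fm -> Prop)
    (Gamma : set Fm) (phi : Fm) : Prop :=
  exists Gamma', [/\ Gamma' `<=` Gamma, vars Gamma' `<=` var phi
                   & entl Gamma' phi].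

Definition restricted_rules (S : hilbert_logic L V) : set (set Fm * Fm) :=
  [set r | rules S r /\ vars r.1 `<=` var r.2].

Lemma restricted_rules_subst (S : hilbert_logic L V) sigma Gamma alpha :
  restricted_rules S (Gamma, alpha) ->
  restricted_rules S (subst sigma @` Gamma, subst sigma alpha).
Proof.
move=> [RS /= sub]; split; first exact: rules_subst.
move=> y [_ [gamma Gg <-]] /=; rewrite !var_subst => -[x xg yx].
by exists x => //; apply: sub; exists gamma.
Qed.

Definition restricted_companion (S : hilbert_logic L V) : hilbert_logic L V :=
  HilbertLogic (@axioms_subst L V S) (@restricted_rules_subst S).

End Companions.

(* Main.v *)
(** Restricted rules have all variables of their premises in their conclusion,
    so deleting from a restricted derivation of [phi] every formula with a
    variable outside [var phi] leaves a derivation of [phi] in the original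
    logic: whenever a conclusion survives, so do the premises it was obtained
    from. *)
Require Import Defs.
From mathcomp Require Import all_boot.
From mathcomp Require Import boolp classical_sets functions cardinality.

Local Open Scope classical_set_scope.

(** [derivation] quantifies over splittings of a list; this lifts a splitting of the filtered list
    to one of the original, where the given derivation can be consulted. *)
Lemma filter_eq_cat_cons {T : Type} {p : pred T} {s s1 : seq T} {x s2} :
  filter p s = s1 ++ x :: s2 ->
  p x /\ exists t1 t2, s = t1 ++ x :: t2 /\ filter p t1 = s1.
Proof.
elim: s s1 => [|y s IHs] s1 /=; first by case: s1.
have [py|npy] := boolP (p y); last first.
  move=> /IHs [px [t1 [t2 [-> <-]]]]; split=> //.
  by exists (y :: t1), t2; rewrite /= (negbTE npy).
case: s1 => [[<- _]|z s1 [<- /IHs [px [t1 [t2 [-> <-]]]]]].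
  by split=> //; exists [::], s.
by split=> //; exists (y :: t1), t2; rewrite /= py.
Qed.

Lemma derivation_filter_var {L : language} {V : Type} {S : hilbert_logic L V}
    {Sigma : set (formula L V)} (X : set V) {s : seq (formula L V)} :
  derivation (restricted_companion S) Sigma s ->
  derivation S (Sigma `&` [set gamma | var gamma `<=` X])
    [seq gamma <- s | `[< var gamma `<=` X >]].
Proof.
move=> ds s1 alpha s2 /filter_eq_cat_cons [/asboolP aX [t1 [t2 [es <-]]]].
case: (ds _ _ _ es) => [Aa|Sa|[Gamma [RG /= GA] Gt]].
- exact: Or31.
- exact: Or32.
apply: Or33; exists Gamma => // gamma Gg /=.
apply/List.filter_In; split; first exact: Gt.
(* Variables of [gamma] lie in [var alpha] by the restriction [GA], hence in [X] by [aX]. *)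
apply/asboolP => x xg; apply/aX/GA.
by exists gamma.
Qed.

Theorem theorem3p6 (L : language) (V : Type) (hV : ([set: V] #= [set: nat])%card)
    (S : hilbert_logic L V) (Sigma : set (formula L V)) (phi : formula L V) :
  entails (restricted_companion S) Sigma phi ->
  left_companion (entails S) Sigma phi.
Proof.
move=> [s /(derivation_filter_var (var phi))].
(* [phi] passes its own filter, so the filtered list still ends in [phi]. *)
rewrite filter_rcons asboolT // => ds.
exists (Sigma `&` [set gamma | var gamma `<=` var phi]); split.
- by move=> gamma [].
- by move=> x [gamma [_ sub] xg]; exact: sub.
- by eexists; exact: ds.
Qed.
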